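(* Consider the discrete-time LTI system $x_{t+1}=Ax_t+Bu_t$, $y_t=Cx_t+Du_t$ with $x_t\in\mathbb{R}^n$, $u_t\in\mathbb{R}^m$, $y_t\in\mathbb{R}^p$, where $(A,B)$ is controllable and $(A,C)$ is observable. Let $\{u^d_k,y^d_k\}_{k=0}^{N-1}$ be an input-output trajectory of this system, and assume that $u^d$ is persistently exciting of order $2n+1$. Define $$H_{n+1}=\begin{bmatrix} H_{n+1}(u^d)\\ H_{n+1}(y^d)\end{bmatrix},\qquad \hat I_m=1_{n+1}\otimes I_m,\qquad \hat I_p=1_{n+1}\otimes I_p,$$ $$\begin{bmatrix} S_u & S_y\end{bmatrix}=\left(H_{n+1}H_{n+1}^\dagger-I_{(m+p)(n+1)}\right)\begin{bmatrix}\hat I_m & 0\\ 0&\hat I_p\end{bmatrix},$$ where $S_u$ consists of the first $m$ columns and $S_y$ of the last $p$ columns. Then: (i) An input-output pair $(u,y)\in\mathbb{R}^m\times\mathbb{R}^p$ is an equilibrium of the system if and only if $S_u u+S_y y=0$. (ii) Let $y\in\mathbb{R}^p$ be any steady-state output of the system (i.e. there is some $u'\in\mathbb{R}^m$ such that $(u',y)$ is an equilibrium) and let $v\in\mathbb{R}^m$. The solution to $$\min_{u\in\mathbb{R}^m}\|u-v\|\quad\text{subject to } (u,y)\text{ being an equilibrium of the system}$$ is $$u=(I_m-S_u^\dagger S_u)v-S_u^\dagger S_y y.$$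
   Context: A finite sequence $\{u_k,y_k\}_{k=0}^{L-1}$ is a trajectory of the system if there is an initial state $x_0\in\mathbb{R}^n$ such that $x_{k+1}=Ax_k+Bu_k$ and $y_k=Cx_k+Du_k$ hold along it. For a sequence $z=\{z_k\}_{k=1}^{N}$ of vectors, $H_L(z)$ denotes the block Hankel matrix with $L$ block rows and $N-L+1$ columns whose $(i,j)$ block is $z_{i+j-1}$ (for sequences indexed from $0$ to $N-1$ the indices are shifted accordingly). A signal $\{u_k\}_{k=0}^{N-1}$ with $u_k\in\mathbb{R}^m$ is persistently exciting of order $L$ if $\operatorname{rank}(H_L(u))=mL$. An input-output pair $(u^s,y^s)$ is an equilibrium (equivalently, a steady state) of the system if the sequence $\{u_k,y_k\}_{k=0}^{n}$ with $(u_k,y_k)=(u^s,y^s)$ for all $k=0,\dots,n$ is a trajectory of the system. Notation: $M^\dagger$ is the Moore-Penrose pseudoinverse, $\otimes$ the Kronecker product, $1_{k}\in\mathbb{R}^{k}$ the all-ones vector, $I_k$ the $k\times k$ identity matrix, $\|\cdot\|$ the Euclidean norm. *)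

(* Defs.v *)
From mathcomp Require Import all_boot all_order all_algebra.
From mathcomp Require Import reals mxtens.

Set Implicit Arguments.
Unset Strict Implicit.
Unset Printing Implicit Defensive.

Import Order.TTheory GRing.Theory Num.Theory.
Local Open Scope ring_scope.

(* A finite sequence {z_k}_{k=0}^{N-1} of vectors is a function nat -> 'cV_q   *)
(* together with its length N: every notion below reads only z_0, ..., z_(N-1). *)

Section Norm.
Variable R : realType.

(* The norm that MathComp-Analysis puts on matrices is the max-norm. *)
Definition norm2 m (u : 'cV[R]_m) : R := Num.sqrt (\sum_(i < m) u i 0 ^+ 2).

Definition is_minimizer (T : Type) (feasible : T -> Prop) (f : T -> R) (u : T) :=
  feasible u /\ forall w, feasible w -> f u <= f w.

End Norm.

Section MoorePenrose.
Variable R : realType.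

Definition is_pinv m n (M : 'M[R]_(m, n)) (X : 'M[R]_(n, m)) : bool :=
  [&& M *m X *m M == M, X *m M *m X == X,
      (M *m X)^T == M *m X & (X *m M)^T == X *m M].

Lemma gram_unit m n (M : 'M[R]_(m, n)) : row_free M -> M *m M^T \in unitmx.
Proof.
move=> fM; rewrite -row_free_unit -kermx_eq0; apply/eqP/row_matrixP => i.
rewrite row0; set x := row i _.
have xMM : x *m M *m M^T = 0.
  by rewrite -mulmxA; apply/sub_kermxP; exact: row_sub.
have /matrixP/(_ 0 0) : x *m M *m (x *m M)^T = 0 by rewrite trmx_mul mulmxA xMM mul0mx.
rewrite mxE [RHS]mxE => /eqP; rewrite psumr_eq0; last first.
  by move=> j _; rewrite [X in _ * X]mxE -expr2 sqr_ge0.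
move=> /allP s0; apply: (row_free_inj fM); rewrite mul0mx; apply/rowP => j.
have /implyP/(_ isT) := s0 j (mem_index_enum _).
by rewrite [_^T _ _]mxE -expr2 sqrf_eq0 => /eqP ->; rewrite mxE.
Qed.

Lemma pinv_exists m n (M : 'M[R]_(m, n)) : exists X, is_pinv M X.
Proof.
have fC : row_free (col_base M)^T.
  by rewrite /row_free mxrank_tr; exact: col_base_full.
have := mulmx_base M; move: (row_base_free M) fC.
move: (\rank M) (col_base M) (row_base M) => r C F fF fC defM.
have uF := gram_unit fF.
have uC : C^T *m C \in unitmx by have := gram_unit fC; rewrite trmxK.
set G := invmx (F *m F^T); set K := invmx (C^T *m C).
have GT : G^T = G by rewrite /G trmx_inv trmx_mul trmxK.
have KT : K^T = K by rewrite /K trmx_inv trmx_mul trmxK.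
have FG Y : F *m (F^T *m (G *m Y)) = Y :> 'M_(r, m).
  by rewrite mulmxA mulKVmx.
have KC k (Y : 'M_(r, k)) : K *m (C^T *m (C *m Y)) = Y.
  by rewrite (mulmxA C^T) mulKmx.
set X := F^T *m (G *m (K *m C^T)).
have MX : M *m X = C *m (K *m C^T) by rewrite -defM -mulmxA FG.
have XM : X *m M = F^T *m (G *m F) by rewrite -defM /X -!mulmxA KC.
exists X; apply/and4P; split; apply/eqP.
- by rewrite MX -defM -!mulmxA KC.
- by rewrite XM /X -!mulmxA FG.
- by rewrite MX !trmx_mul trmxK KT mulmxA.
- by rewrite XM !trmx_mul trmxK GT mulmxA.
Qed.

Lemma pinv_unique m n (M : 'M[R]_(m, n)) X Y :
  is_pinv M X -> is_pinv M Y -> X = Y.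
Proof.
move=> /and4P[/eqP x1 /eqP x2 /eqP x3 /eqP x4].
move=> /and4P[/eqP y1 /eqP y2 /eqP y3 /eqP y4].
have eMX : M *m X = M *m Y.
  rewrite -{1}y1 -[M *m Y *m M *m X]mulmxA -y3 -x3 -trmx_mul.
  by rewrite mulmxA x1 y3.
have eXM : X *m M = Y *m M.
  rewrite -{1}y1 -(mulmxA M) mulmxA -x4 -y4 -trmx_mul.
  by rewrite -mulmxA (mulmxA M) x1 y4.
by rewrite -x2 eXM -mulmxA eMX mulmxA y2.
Qed.

Definition pinv m n (M : 'M[R]_(m, n)) : 'M[R]_(n, m) := xchoose (pinv_exists M).

Lemma pinvP m n (M : 'M[R]_(m, n)) : is_pinv M (pinv M).
Proof. exact: xchooseP. Qed.

End MoorePenrose.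

Section Hankel.
Variable R : realType.

(* Row i * q + a is the a-th component of block row i, the same numbering as in *)
(* the Kronecker product *t. There are no columns when N < L.                   *)
Definition hankel q (L N : nat) (z : nat -> 'cV[R]_q) : 'M[R]_(L * q, N.+1 - L) :=
  \matrix_(r, j) z ((mxtens_unindex r).1 + j)%N (mxtens_unindex r).2 0.

Definition persistently_exciting m (L N : nat) (u : nat -> 'cV[R]_m) : Prop :=
  \rank (hankel L N u) = (m * L)%N.

(* 1_k \otimes I_q; the cast identifies 1 * q columns with q columns. *)
Definition stacked_id (k q : nat) : 'M[R]_(k * q, q) :=
  castmx (erefl _, mul1n q) ((const_mx 1 : 'cV[R]_k) *t (1%:M : 'M[R]_q)).

End Hankel.

Section System.
Variables (R : realType) (n m p : nat).
Variables (A : 'M[R]_n) (B : 'M[R]_(n, m)) (C : 'M[R]_(p, n)) (D : 'M[R]_(p, m)).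

Fixpoint state (x0 : 'cV[R]_n) (u : nat -> 'cV[R]_m) (k : nat) : 'cV[R]_n :=
  if k is k'.+1 then A *m state x0 u k' + B *m u k' else x0.

Definition controllable : Prop :=
  forall x0 x1 : 'cV[R]_n, exists (T : nat) (u : nat -> 'cV[R]_m), state x0 u T = x1.

(* Observability of the pair (A, C): the unforced output over some finite       *)
(* horizon determines the initial state (a known input contributes the same     *)
(* term to both outputs, hence plays no role).                                  *)
Definition observable : Prop :=
  exists T : nat, forall x0 x1 : 'cV[R]_n,
    (forall k, (k < T)%N -> C *m (A ^+ k *m x0) = C *m (A ^+ k *m x1)) -> x0 = x1.

Definition is_trajectory (L : nat) (u : nat -> 'cV[R]_m) (y : nat -> 'cV[R]_p) : Prop :=
  exists x0 : 'cV[R]_n,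
    forall k, (k < L)%N -> y k = C *m state x0 u k + D *m u k.

Definition is_equilibrium (us : 'cV[R]_m) (ys : 'cV[R]_p) : Prop :=
  is_trajectory n.+1 (fun=> us) (fun=> ys).

End System.

(* Main.v *)
Require Import Defs.
From mathcomp Require Import all_boot all_order all_algebra.
From mathcomp Require Import reals mxtens zify.

Set Implicit Arguments.
Unset Strict Implicit.
Unset Printing Implicit Defensive.

Import Order.TTheory GRing.Theory Num.Theory.
Local Open Scope ring_scope.

(* The key is Willems' fundamental lemma: when u^d is persistently exciting of
   order n + L, the trajectories of length L are exactly the combinations of the
   windows of length L of the data.  It follows from the matrix with columns
   (x_k, u_k, ..., u_(k+L-1)) having full row rank.  A left annihilator (xi, e)
   of it yields, by running the dynamics j <= n steps, annihilators whose state
   part is xi A^j; weighting these by the coefficients of the characteristic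
   polynomial cancels the state part, so persistent excitation kills the input
   part.  This gives a monic linear recurrence forcing e = 0 and xi A^i B = 0,
   hence xi = 0 by controllability.  Finally, H H^+ - I vanishes exactly on the
   range of H, and pinv solves the constrained least-norm problem. *)

(** * Monic relations and the recurrences they force *)

Lemma monic_annihilator (R : comNzRingType) n (A : 'M[R]_n) :
  exists2 a : nat -> R, a n = 1 & \sum_(j < n.+1) a j *: A ^+ j = 0.
Proof.
case: n A => [|n] A; first by exists (fun=> 1) => //; exact: flatmx0.
exists (fun j => (char_poly A)`_j).
  by have /monicP := char_poly_monic A; rewrite lead_coefE size_char_poly.
rewrite -[RHS](Cayley_Hamilton A) -[in RHS](coefK (char_poly A)).
rewrite size_char_poly poly_def raddf_sum; apply: eq_bigr => j _ /=.
by rewrite horner_mxZ rmorphXn /= horner_mx_X.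
Qed.

(** Terms of negative index count as 0. The leading coefficient 1 isolates [h r]; the other terms
    are earlier values, which vanish by strong induction. *)
Lemma monic_recurrence_eq0 (R : nzRingType) (V : lmodType R) n (a : nat -> R)
    (h : nat -> V) :
  a n = 1 ->
  (forall r, \sum_(j < n.+1)
     a j *: (if (n <= r + j)%N then h (r + j - n)%N else 0) = 0) ->
  forall r, h r = 0.
Proof.
move=> an1 rec; elim/ltn_ind => r IH.
have := rec r; rewrite big_ord_recr /= leq_addl addnK an1 scale1r.
rewrite big1 ?add0r => [//|j _]; case: ifP => nrj; last by rewrite scaler0.
by rewrite IH ?scaler0//; have := ltn_ord j; lia.
Qed.

(** * Hankel matrices and persistent excitation *)

Section Hankel.
Variable R : realType.

Definition block_row q L (e : nat -> 'rV[R]_q) : 'rV[R]_(L * q) :=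
  \row_r e (mxtens_unindex r).1 0 (mxtens_unindex r).2.

Lemma block_row_surj q L (c : 'rV[R]_(L * q)) : exists e, c = block_row L e.
Proof.
(* From index L on, [e] takes the default value 0. *)
exists (fun t => \row_a oapp (fun i => c 0 (mxtens_index (i, a))) 0 (insub t)).
by apply/rowP => r; rewrite !mxE valK /= -[in LHS](mxtens_unindexK r).
Qed.

Lemma block_row_eq0 q L (e : nat -> 'rV[R]_q) :
  block_row L e = 0 <-> forall t, (t < L)%N -> e t = 0.
Proof.
split=> [e0 t tL|e0]; last by apply/rowP => r; rewrite !mxE e0 ?mxE.
apply/rowP => a; have /rowP/(_ (mxtens_index (Ordinal tL, a))) := e0.
by rewrite !mxE mxtens_indexK.
Qed.

Lemma block_row_hankel q L N (e : nat -> 'rV[R]_q) (z : nat -> 'cV[R]_q) j :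
  col j (block_row L e *m hankel L N z) = \sum_(t < L) e t *m z (t + j)%N.
Proof.
apply/matrixP => i0 j0; rewrite !ord1 mxE [LHS]mxE summxE.
under [RHS]eq_bigr do rewrite mxE.
rewrite (pair_big xpredT xpredT
  (fun (t : 'I_L) a => e t 0 a * z (t + j)%N a 0)) /=.
rewrite (reindex (@mxtens_unindex L q)) /=; last first.
  exists (@mxtens_index L q) => x _; first exact: mxtens_unindexK.
  exact: mxtens_indexK.
by apply: eq_bigr => r _; rewrite !mxE.
Qed.

Lemma block_row_hankel_mul q L N (u z : nat -> 'cV[R]_q)
    (g : 'cV[R]_(N.+1 - L)) :
  (block_row L (fun k => (u k)^T))^T = hankel L N z *m g <->
  forall k, (k < L)%N -> u k = \sum_j g j 0 *: z (k + j)%N.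
Proof.
split=> [ug k kL|uE]; apply/colP => a.
  have /colP/(_ (mxtens_index (Ordinal kL, a))) := ug.
  rewrite !mxE mxtens_indexK /= => ->; rewrite summxE.
  by apply: eq_bigr => j _; rewrite !mxE mxtens_indexK mulrC.
rewrite !mxE uE// summxE.
by apply: eq_bigr => j _; rewrite !mxE mulrC.
Qed.

(** The rank equals the number of rows, so the Hankel matrix has trivial left kernel; [e] lists the
    blocks of a left annihilator. *)
Lemma persistently_excitingP q L N (z : nat -> 'cV[R]_q) :
  persistently_exciting L N z -> forall e : nat -> 'rV[R]_q,
  (forall k, (k + L <= N)%N -> \sum_(t < L) e t *m z (t + k)%N = 0) ->
  forall t, (t < L)%N -> e t = 0.
Proof.
move=> rk e eN.
have fr : row_free (hankel L N z) by rewrite /row_free rk mulnC.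
apply/block_row_eq0/(row_free_inj fr); rewrite mul0mx.
apply/rowP => j; have := block_row_hankel e z j; rewrite eN; last first.
  by have := ltn_ord j; lia.
by move=> /colP/(_ 0); rewrite !mxE.
Qed.

End Hankel.

(** * Controllability, annihilators of the data, and the fundamental lemma *)

Section System.
Variables (R : realType) (n m p : nat).
Variables (A : 'M[R]_n) (B : 'M[R]_(n, m)) (C : 'M[R]_(p, n)) (D : 'M[R]_(p, m)).

(** Such a row kills every state reachable from 0, in particular each basis vector. *)
Lemma controllable_left_eq0 (xi : 'rV[R]_n) :
  controllable A B -> (forall i, xi *m A ^+ i *m B = 0) -> xi = 0.
Proof.
(* The row is generalized because the induction passes from [zeta] to [zeta *m A]. *)
move=> ctrl xiAB; have xi0 T u (zeta : 'rV[R]_n) :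
    (forall i, zeta *m A ^+ i *m B = 0) -> zeta *m state A B 0 u T = 0.
  elim: T zeta => [|T IH] zeta zAB /=; first by rewrite mulmx0.
  rewrite mulmxDr !mulmxA -[X in _ + X *m _](_ : zeta *m A ^+ 0 *m B = _).
    rewrite zAB mul0mx addr0 IH// => i; rewrite -(mulmxA zeta).
    by have := zAB i.+1; rewrite exprS.
  by rewrite expr0 mulmx1.
apply/rowP => j; have [T [u uT]] := ctrl 0 (col j 1%:M).
have /colP/(_ 0) : xi *m col j 1%:M = 0 by rewrite -uT xi0.
by rewrite colE mul1mx -colE !mxE.
Qed.

Section Annihilator.
Variables (ud : nat -> 'cV[R]_m) (x0 : 'cV[R]_n) (N L : nat).
Let x := state A B x0 ud.

(** Substituting the dynamics into the relation at time k+1 creates the input coefficient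
    [xi *m A ^+ j *m B], the next value of [h]; since [h] is read backwards, it lands in front of
    the old coefficients. *)
Lemma annihilator_shift (xi : 'rV[R]_n) (h : nat -> 'rV[R]_m) :
  (forall i, h (L + i)%N = xi *m A ^+ i *m B) ->
  (forall k, (k + L <= N)%N ->
     xi *m x k + \sum_(t < L) h (L - t.+1)%N *m ud (t + k)%N = 0) ->
  forall j k, (k + (L + j) <= N)%N ->
    xi *m A ^+ j *m x k +
      \sum_(t < L + j) h (L + j - t.+1)%N *m ud (t + k)%N = 0.
Proof.
move=> hL ann; elim=> [|j IH] k kN.
  by rewrite expr0 mulmx1; have := ann k; rewrite !addn0; apply; lia.
have := IH k.+1; rewrite addnS big_ord_recl /= subSS subn0 hL add0n.
rewrite exprSr => IHk; rewrite -[RHS]IHk; last by lia.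
rewrite mulmxDr !mulmxA addrA; congr (_ + _); apply: eq_bigr => t _.
by rewrite subSS addnS.
Qed.

Lemma state_input_row_free : controllable A B ->
  persistently_exciting (n + L) N ud ->
  row_free (col_mx (\matrix_(i < n, j < N.+1 - L) x j i 0) (hankel L N ud)).
Proof.
move=> ctrl pe; set M := col_mx _ _.
rewrite -kermx_eq0; apply/eqP/row_matrixP => i0; rewrite row0.
have : row i0 (kermx M) *m M = 0 by apply/sub_kermxP; exact: row_sub.
rewrite -[row i0 _]hsubmxK; move: (lsubmx _) (rsubmx _) => xi c.
have [e ->] := block_row_surj c; rewrite mul_row_col => annM.
have ann k : (k + L <= N)%N ->
    xi *m x k + \sum_(t < L) e t *m ud (t + k)%N = 0.
  move=> kN; have kL : (k < N.+1 - L)%N by lia.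
  rewrite -(block_row_hankel e ud (Ordinal kL)).
  have /colP/(_ 0) := congr1 (col (Ordinal kL)) annM.
  rewrite !mxE => annk; apply/colP => i; rewrite !ord1 !mxE -[RHS]annk.
  congr (_ + _).
  by apply: eq_bigr => a _; rewrite !mxE.
(* e read backwards, followed by the xi A^i B: all the shifted annihilators
   are then windows of this one sequence. *)
pose h s := if (s < L)%N then e (L - s.+1)%N else xi *m A ^+ (s - L) *m B.
have hL i : h (L + i)%N = xi *m A ^+ i *m B by rewrite /h ltnNge leq_addr addKn.
have he t : (t < L)%N -> h (L - t.+1)%N = e t.
  by move=> tL; rewrite /h ifT; [congr (e _)|]; lia.
have annh k : (k + L <= N)%N ->
    xi *m x k + \sum_(t < L) h (L - t.+1)%N *m ud (t + k)%N = 0.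
  move=> kN; rewrite -[RHS](ann k kN); congr (_ + _).
  by apply: eq_bigr => t _; rewrite he.
have [a an1 aA] := monic_annihilator A.
have xiA q (P : 'M_(n, q)) : \sum_(j < n.+1) a j *: (xi *m A ^+ j *m P) = 0.
  transitivity (xi *m (\sum_(j < n.+1) a j *: A ^+ j) *m P).
    rewrite mulmx_sumr mulmx_suml; apply: eq_bigr => j _.
    by rewrite -scalemxAr -scalemxAl.
  by rewrite aA mulmx0 mul0mx.
have h0 : forall r, h r = 0.
  (* For r < n + L the recurrence comes from persistent excitation. Beyond, all indices are at least
     L, where [h] is given by powers of [A], and [xiA] suffices. *)
  apply: (monic_recurrence_eq0 an1) => r; have [rnL|nLr] := ltnP r (n + L).
    (* Input part of the weighted sum of the shifted annihilators, each padded by zeros to length n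
       + L. *)
    pose w t : 'rV_m := \sum_(j < n.+1)
      a j *: (if (t < L + j)%N then h (L + j - t.+1)%N else 0).
    have w0 : forall t, (t < n + L)%N -> w t = 0.
      apply: (persistently_excitingP pe) => k kN.
      transitivity (\sum_(j < n.+1) a j *: (xi *m A ^+ j *m x k +
        \sum_(t < L + j) h (L + j - t.+1)%N *m ud (t + k)%N)).
        under [RHS]eq_bigr do rewrite scalerDr.
        rewrite big_split /= xiA add0r.
        under eq_bigr do rewrite mulmx_suml.
        rewrite exchange_big /=; apply: eq_bigr => j _.
        rewrite scaler_sumr.
        have jn : (L + j <= n + L)%N by have := ltn_ord j; lia.
        rewrite (big_ord_widen _
          (fun t => a j *: (h (L + j - t.+1)%N *m ud (t + k)%N)) jn).
        rewrite [RHS]big_mkcond; apply: eq_bigr => t _.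
        by case: ifP => _; rewrite -scalemxAl ?mul0mx ?scaler0.
      apply: big1 => j _; rewrite (annihilator_shift hL annh) ?scaler0//.
      by have := ltn_ord j; lia.
    (* Reversing the index turns [w] into the left side of the recurrence. *)
    rewrite -[RHS](w0 (n + L - r.+1)%N); last by lia.
    apply: eq_bigr => j _; congr (_ *: _).
    have -> : (n <= r + j)%N = (n + L - r.+1 < L + j)%N by lia.
    by case: ifP => // _; congr (h _); lia.
  rewrite -[RHS](xiA _ (A ^+ (r - (n + L)) *m B)); apply: eq_bigr => j _.
  rewrite ifT; last by lia.
  have -> : (r + j - n = L + (j + (r - (n + L))))%N by lia.
  by rewrite hL exprD !mulmxA.
have -> : xi = 0 by apply: controllable_left_eq0 => // i; rewrite -hL.
by rewrite (block_row_eq0 _ _).2 ?row_mx0// => t tL; rewrite -he.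
Qed.

End Annihilator.

Lemma state_sum (I : finType) (g : I -> R) (x0 : I -> 'cV[R]_n)
    (u : I -> nat -> 'cV[R]_m) k :
  state A B (\sum_i g i *: x0 i) (fun k => \sum_i g i *: u i k) k =
  \sum_i g i *: state A B (x0 i) (u i) k.
Proof.
elim: k => //= k ->; rewrite !mulmx_sumr -big_split /=; apply: eq_bigr => i _.
by rewrite scalerDr !scalemxAr.
Qed.

Lemma state_shift (x0 : 'cV[R]_n) (u : nat -> 'cV[R]_m) j k :
  state A B (state A B x0 u j) (fun k => u (k + j)%N) k = state A B x0 u (k + j).
Proof. by elim: k => //= k ->. Qed.

Lemma eq_state (x0 : 'cV[R]_n) (u u' : nat -> 'cV[R]_m) k :
  (forall t, (t < k)%N -> u t = u' t) -> state A B x0 u k = state A B x0 u' k.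
Proof.
elim: k => //= k IH uu'; rewrite IH ?uu'// => t tk.
by apply: uu'; exact: ltnW.
Qed.

(** Full row rank lets one combination of data windows match both the initial state and the input;
    superposition then matches the output. Conversely, the combined data states give the initial
    state. *)
Lemma is_trajectory_span (ud : nat -> 'cV[R]_m) (yd : nat -> 'cV[R]_p) N L :
  controllable A B -> is_trajectory A B C D N ud yd ->
  persistently_exciting (n + L) N ud ->
  forall (u : nat -> 'cV[R]_m) (y : nat -> 'cV[R]_p),
  is_trajectory A B C D L u y <->
  exists g : 'I_(N.+1 - L) -> R, forall k, (k < L)%N ->
    u k = \sum_j g j *: ud (k + j)%N /\ y k = \sum_j g j *: yd (k + j)%N.
Proof.
move=> ctrl [xd0 ydE] pe u y; pose xd := state A B xd0 ud.
have span (g : 'I_(N.+1 - L) -> R) k : (k < L)%N ->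
    (forall t, (t < L)%N -> u t = \sum_j g j *: ud (t + j)%N) ->
    C *m state A B (\sum_j g j *: xd j) u k + D *m u k =
    \sum_j g j *: yd (k + j)%N.
  move=> kL uE; pose us t := \sum_j g j *: ud (t + j)%N.
  rewrite (@eq_state _ _ us); last by move=> t tk; apply: uE; lia.
  rewrite uE// state_sum !mulmx_sumr -big_split /=; apply: eq_bigr => j _.
  rewrite state_shift ydE ?scalerDr ?scalemxAr//.
  by have := ltn_ord j; lia.
split=> [[x0 yE]|[g ug]].
  have fr := state_input_row_free xd0 ctrl pe.
  pose w := col_mx x0 (block_row L (fun t => (u t)^T))^T.
  set M := col_mx _ _ in fr; pose g := pinvmx M *m w.
  have : M *m g = w by rewrite mulmxA mulmxVp// mul1mx.
  rewrite mul_col_mx => /eq_col_mx[xg ug]; exists (fun j => g j 0).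
  move/esym/block_row_hankel_mul: ug => uE.
  move=> k kL; split; first exact: uE.
  rewrite yE// -span//; congr (C *m state A B _ _ _ + _).
  apply/colP => i; rewrite -xg mxE summxE.
  by apply: eq_bigr => j _; rewrite !mxE mulrC.
exists (\sum_j g j *: xd j) => k kL.
by rewrite span => [|//|t /ug[]]; first case: (ug k kL).
Qed.

End System.

(** * Pseudoinverse, range membership and least-norm solutions *)

Section MoorePenrose.
Variable R : realType.

Lemma norm2_sqr q (u : 'cV[R]_q) : norm2 u ^+ 2 = (u^T *m u) 0 0.
Proof.
rewrite sqr_sqrtr; last by apply: sumr_ge0 => i _; exact: sqr_ge0.
by rewrite mxE; apply: eq_bigr => i _; rewrite mxE expr2.
Qed.

Lemma norm2_sqrD q (u v : 'cV[R]_q) : u^T *m v = 0 ->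
  norm2 (u + v) ^+ 2 = norm2 u ^+ 2 + norm2 v ^+ 2.
Proof.
move=> uv0; have vu0 : v^T *m u = 0.
  by rewrite -[LHS]trmxK trmx_mul trmxK uv0 trmx0.
rewrite !norm2_sqr [(u + v)^T]linearD /= mulmxDl !mulmxDr uv0 vu0 addr0 add0r.
by rewrite mxE.
Qed.

Lemma norm2_eq0 q (u : 'cV[R]_q) : norm2 u = 0 -> u = 0.
Proof.
move=> /eqP; rewrite -sqrf_eq0 norm2_sqr mxE psumr_eq0; last first.
  by move=> i _; rewrite mxE -expr2 sqr_ge0.
move=> /allP u0; apply/colP => i.
have /implyP/(_ isT) := u0 i (mem_index_enum _).
by rewrite [_^T _ _]mxE -expr2 sqrf_eq0 => /eqP ->; rewrite mxE.
Qed.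

Lemma mul_pinv_sub1_eq0 q r (M : 'M[R]_(q, r)) (w : 'cV[R]_q) :
  (M *m pinv M - 1%:M) *m w = 0 <-> exists g, w = M *m g.
Proof.
rewrite mulmxBl mul1mx; split=> [/eqP|[g ->]].
  by rewrite subr_eq0 -mulmxA => /eqP <-; exists (pinv M *m w).
by have /and4P[/eqP MXM _ _ _] := pinvP M; rewrite mulmxA MXM subrr.
Qed.

(* The correction to v lies in the range of pinv M, which is orthogonal to the
   kernel of M, so Pythagoras compares it with every other feasible point. *)
Lemma is_minimizer_pinv q r (M : 'M[R]_(q, r)) (b : 'cV[R]_q) (v u : 'cV[R]_r) :
  (exists w, M *m w = b) ->
  is_minimizer (fun w => M *m w = b) (fun w => norm2 (w - v)) u <->
  u = v - pinv M *m (M *m v - b).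
Proof.
move=> [w0 Mw0]; have /and4P[/eqP MXM /eqP XMX _ /eqP XMT] := pinvP M.
set s := v - _.
have Ms : M *m s = b.
  by rewrite /s -Mw0 -mulmxBr [LHS]mulmxBr !mulmxA MXM -mulmxBr subKr.
have pyth w : M *m w = b ->
    norm2 (w - v) ^+ 2 = norm2 (s - v) ^+ 2 + norm2 (w - s) ^+ 2.
  move=> Mw; rewrite -norm2_sqrD; first by rewrite [_ + (w - s)]addrC addrA subrK.
  have -> : s - v = - (pinv M *m (M *m v - b)) by rewrite /s addrC addKr.
  (* Writing X = (XM)X with XM symmetric moves [M] onto [w - s], which it kills. *)
  rewrite -XMX -mulmxA linearN /= trmx_mul XMT mulNmx.
  by rewrite -mulmxA -(mulmxA (pinv M)) (mulmxBr M) Mw Ms subrr !mulmx0 oppr0.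
have norm2_ge0 (w : 'cV[R]_r) : 0 <= norm2 w by exact: sqrtr_ge0.
split=> [[Mu umin]|->].
  (* By Pythagoras, minimality against [s] forces the squared norm of [u - s] to be at most 0. *)
  apply/eqP; rewrite -subr_eq0; apply/eqP/norm2_eq0/eqP.
  rewrite -sqrf_eq0 eq_le sqr_ge0 andbT.
  by rewrite -(lerD2l (norm2 (s - v) ^+ 2)) addr0 -pyth// ler_sqr ?nnegrE ?umin.
split=> // w Mw; rewrite -ler_sqr ?nnegrE// (pyth w)// lerDl.
exact: sqr_ge0.
Qed.

End MoorePenrose.

(** * Equilibria as constant trajectories *)

Lemma stacked_idE (R : realType) k q i j :
  stacked_id R k q i j = ((mxtens_unindex i).2 == j)%:R.
Proof.
rewrite castmxE !mxE mul1r; congr (_ == _)%:R; apply: val_inj => //=.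
by rewrite modn_small.
Qed.

Lemma mul_stacked_id (R : realType) k q (u : 'cV[R]_q) :
  stacked_id R k q *m u = (block_row k (fun=> u^T))^T.
Proof.
apply/colP => i; rewrite !mxE (bigD1 (mxtens_unindex i).2)//= big1 => [|a ai].
  by rewrite stacked_idE eqxx mul1r addr0.
by rewrite stacked_idE eq_sym (negbTE ai) mul0r.
Qed.

Theorem lemma1 (R : realType) (n m p N : nat)
  (A : 'M[R]_n) (B : 'M[R]_(n, m)) (C : 'M[R]_(p, n)) (D : 'M[R]_(p, m))
  (ud : nat -> 'cV[R]_m) (yd : nat -> 'cV[R]_p)
  (hAB : controllable A B) (hAC : observable A C)
  (hdata : is_trajectory A B C D N ud yd)
  (hPE : persistently_exciting (2 * n + 1) N ud) :
  let H := col_mx (hankel n.+1 N ud) (hankel n.+1 N yd) in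
  let S := (H *m pinv H - 1%:M) *m
           block_mx (stacked_id R n.+1 m) 0 0 (stacked_id R n.+1 p) in
  let Su := lsubmx S in
  let Sy := rsubmx S in
  (forall (u : 'cV[R]_m) (y : 'cV[R]_p),
     is_equilibrium A B C D u y <-> Su *m u + Sy *m y = 0) /\
  (forall (y : 'cV[R]_p) (v : 'cV[R]_m),
     (exists u' : 'cV[R]_m, is_equilibrium A B C D u' y) ->
     forall u : 'cV[R]_m,
       is_minimizer (fun w : 'cV[R]_m => is_equilibrium A B C D w y)
                    (fun w : 'cV[R]_m => norm2 (w - v)) u <->
       u = (1%:M - pinv Su *m Su) *m v - pinv Su *m Sy *m y).
Proof.
move=> H S Su Sy.
have SE u y : Su *m u + Sy *m y = (H *m pinv H - 1%:M) *m
    col_mx (block_row n.+1 (fun=> u^T))^T (block_row n.+1 (fun=> y^T))^T.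
  rewrite -mul_row_col hsubmxK /S -mulmxA mul_block_col !mul0mx addr0 add0r.
  by rewrite !mul_stacked_id.
have equiE u y : is_equilibrium A B C D u y <-> Su *m u + Sy *m y = 0.
  rewrite SE mul_pinv_sub1_eq0.
  (* 2n + 1 = n + (n + 1) is the order required for windows of length n + 1. *)
  have pe : persistently_exciting (n + n.+1) N ud.
    by rewrite addnS addnn -mul2n -addn1.
  rewrite /is_equilibrium (is_trajectory_span hAB hdata pe); split=> [[g gE]|[g]].
    exists (\col_j g j); rewrite mul_col_mx; congr col_mx;
      apply/block_row_hankel_mul => k /gE[uE yE].
      by rewrite uE; apply: eq_bigr => j _; rewrite mxE.
    by rewrite yE; apply: eq_bigr => j _; rewrite mxE.
  rewrite mul_col_mx => /eq_col_mx[/block_row_hankel_mul uE].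
  move=> /block_row_hankel_mul yE.
  by exists (fun j => g j 0) => k kL; rewrite -uE// -yE.
have feasE y w : is_equilibrium A B C D w y <-> Su *m w = - (Sy *m y).
  by rewrite equiE; split=> [/eqP|->]; rewrite ?addNr// addr_eq0 => /eqP.
split=> // y v [u' /feasE u'E] u.
(* This is the least-norm formula with right-hand side [- (Sy *m y)]. *)
have -> : (1%:M - pinv Su *m Su) *m v - pinv Su *m Sy *m y =
    v - pinv Su *m (Su *m v - - (Sy *m y)).
  by rewrite opprK mulmxBl mul1mx mulmxDr !mulmxA opprD addrA.
rewrite -is_minimizer_pinv; last by exists u'.
by split=> -[/feasE uE umin]; split=> // w /feasE; exact: umin.
Qed.
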